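(* Let $G=(V,E)$ be a finite weakly connected directed graph whose condensation $\mathbb G$ has exactly one sink vertex. Let $\mathcal H=\mathbb C^{V}$ with orthonormal basis $\{|v\rangle : v\in V\}$ and let $\mathcal L=\{c_{(v,w)}|w\rangle\langle v| : (v,w)\in E\}$ for arbitrary nonzero constants $c_{(v,w)}\in\mathbb C\setminus\{0\}$. Then for an arbitrary Hermitian operator $H$ on $\mathcal H$, the GKSL evolution $$\frac{d}{dt}\varrho=-\mathrm i[H,\varrho]+\sum_{L\in\mathcal L}\Big(L\varrho L^\dagger-\tfrac12\{L^\dagger L,\varrho\}\Big)$$ is relaxing, i.e. it has a unique stationary state.
   Context: A digraph is weakly connected if its underlying undirected graph is connected. The condensation $\mathbb G$ of $G$ is the directed graph whose vertices are the maximal strongly connected components of $G$, with an arc from component $\mathbf v$ to component $\mathbf w\ne\mathbf v$ iff there exist $v\in\mathbf v$, $w\in\mathbf w$ with $(v,w)\in E$; it is acyclic. A sink vertex is a vertex of outdegree zero. A stationary state is a density matrix $\varrho$ with right-hand side equal to $0$; relaxing means the stationary state is unique. $\{A,B\}=AB+BA$. *)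

(* Defs.v *)
From HB Require Import structures.
From mathcomp Require Import all_boot all_order all_algebra.
Set Implicit Arguments. Unset Strict Implicit. Unset Printing Implicit Defensive.
Import Order.TTheory GRing.Theory Num.Theory.
Local Open Scope ring_scope.

Definition weakly_connected n (E : rel 'I_n) : Prop :=
  forall v w : 'I_n, connect (fun x y => E x y || E y x) v w.

Definition scc n (E : rel 'I_n) (v : 'I_n) : {set 'I_n} :=
  [set u | connect E v u && connect E u v].

Definition cond_vertices n (E : rel 'I_n) : {set {set 'I_n}} :=
  [set scc E v | v in 'I_n].

Definition cond_arc n (E : rel 'I_n) (C D : {set 'I_n}) : bool :=
  (C != D) && [exists v in C, exists w in D, E v w].

Definition cond_sinks n (E : rel 'I_n) : {set {set 'I_n}} :=
  [set C in cond_vertices E | [forall D in cond_vertices E, ~~ cond_arc E C D]].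

Definition adj (C : numClosedFieldType) n (A : 'M[C]_n) : 'M[C]_n :=
  map_mx Num.conj (A^T).

Definition is_hermitian (C : numClosedFieldType) n (A : 'M[C]_n) : Prop :=
  adj A = A.

Definition psd (C : numClosedFieldType) n (A : 'M[C]_n) : Prop :=
  is_hermitian A /\
  forall x : 'cV[C]_n, 0 <= (map_mx Num.conj (x^T) *m A *m x) ord0 ord0.

Definition density (C : numClosedFieldType) n (rho : 'M[C]_n) : Prop :=
  psd rho /\ \tr rho = 1.

Definition jump (C : numClosedFieldType) n (c : C) (v w : 'I_n) : 'M[C]_n :=
  c *: delta_mx w v.

Definition gksl (C : numClosedFieldType) n (E : rel 'I_n) (c : 'I_n -> 'I_n -> C)
    (H rho : 'M[C]_n) : 'M[C]_n :=
  - 'i *: (H *m rho - rho *m H) +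
  \sum_(p : 'I_n * 'I_n | E p.1 p.2)
     (let L := jump (c p.1 p.2) p.1 p.2 in
      L *m rho *m adj L
      - 2^-1 *: (adj L *m L *m rho + rho *m (adj L *m L))).

Definition stationary (C : numClosedFieldType) n (E : rel 'I_n)
    (c : 'I_n -> 'I_n -> C) (H rho : 'M[C]_n) : Prop :=
  density rho /\ gksl E c H rho = 0.

Definition relaxing (C : numClosedFieldType) n (E : rel 'I_n)
    (c : 'I_n -> 'I_n -> C) (H : 'M[C]_n) : Prop :=
  exists! rho : 'M[C]_n, stationary E c H rho.

(* Main.v *)
(* Diagonalize a Hermitian [X] in the kernel of the generator as
   [X = U^* diag(d) U].  The diagonal of [gksl X] in the eigenbasis does not see
   [H] and says that [d] is balanced for the classical rates
   [w i j = \sum_L |(U L U^* ) i j|^2].  Hence no rate leaves [{d > 0}], i.e. the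
   positive eigenspaces span a subspace invariant under every jump operator; the
   same holds for the negative ones.  A nonzero invariant subspace contains the
   basis vector of every globally reachable vertex, so the two orthogonal
   subspaces cannot both be nonzero: [X] is semidefinite, and zero if traceless.
   This gives uniqueness; for existence, the generator is singular because its
   values are traceless, and it commutes with the adjoint, so it kills some nonzero
   Hermitian matrix. *)
Require Import Defs.
From HB Require Import structures.
From mathcomp Require Import all_boot all_order all_algebra.
Import Order.TTheory GRing.Theory Num.Theory.
Local Open Scope ring_scope.
Set Implicit Arguments. Unset Strict Implicit. Unset Printing Implicit Defensive.

(** * Strong components and classical balance equations *)

Lemma mem_scc n (E : rel 'I_n) v u :
  (u \in scc E v) = connect E v u && connect E u v.
Proof. by rewrite inE. Qed.

Lemma scc_eq n (E : rel 'I_n) (u v : 'I_n) : u \in scc E v -> scc E u = scc E v.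
Proof.
rewrite mem_scc => /andP[vu uv]; apply/setP => x; rewrite !mem_scc.
apply/andP/andP => -[h1 h2]; split.
- exact: connect_trans vu h1.
- exact: connect_trans h2 uv.
- exact: connect_trans uv h1.
- exact: connect_trans h2 vu.
Qed.

(* A vertex reachable from [v] whose set of descendants has minimal size lies in
   a terminal component. *)
Lemma reaches_cond_sink n (E : rel 'I_n) (v : 'I_n) :
  exists2 u, connect E v u & scc E u \in cond_sinks E.
Proof.
case: (@arg_minnP _ v (connect E v) (fun u => #|[set x | connect E u x]|))
  => [|u vu umin]; first exact: connect0.
exists u => //; rewrite inE imset_f //=.
apply/'forall_implyP => _ /imsetP[x _ ->]; apply/negP => /andP[neq].
case/'exists_andP => a [ua] /'exists_andP[b [xb ab]].
have ub : connect E u b.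
  by move: ua; rewrite mem_scc => /andP[ua _]; exact: connect_trans ua (connect1 ab).
have sub : [set y | connect E b y] \subset [set y | connect E u y].
  by apply/subsetP => y; rewrite !inE; exact: connect_trans.
(* By minimality the descendants of [b] are all those of [u]; hence [b] reaches [u], and the arc
   from [u]'s component leads back into it. *)
have /eqP bu : [set y | connect E b y] == [set y | connect E u y].
  by rewrite eqEcard sub umin //; exact: connect_trans ub.
have bs : b \in scc E u.
  by move/setP/(_ u): bu; rewrite mem_scc !inE connect0 ub => ->.
by rewrite -(scc_eq xb) (scc_eq bs) eqxx in neq.
Qed.

Lemma globally_reachable n (E : rel 'I_n) :
  #|cond_sinks E| = 1%N -> exists s, forall v, connect E v s.
Proof.
move=> /eqP/cards1P[S sinkS].
have: S \in cond_sinks E by rewrite sinkS set11.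
rewrite inE => /andP[/imsetP[s _ Ss] _]; exists s => v.
have [u vu] := reaches_cond_sink E v.
rewrite sinkS Ss inE => /eqP/setP/(_ s); rewrite !mem_scc connect0 /=.
by move=> /andP[us _]; exact: connect_trans us.
Qed.

(** Summed over [A], the balance equations lose their internal terms by symmetry, so the net flow
    out of [A] is zero. Each crossing term [w j i * d i - w i j * d j] is nonnegative by the signs
    of [d], hence zero; then [w j i * d i] is at most zero while [d i] is positive. *)
Lemma balanced_rates_closed (C : numDomainType) (I : finType) (w : I -> I -> C)
    (d : I -> C) (A : {pred I}) :
  (forall i j, 0 <= w i j) ->
  (forall i, \sum_j (w i j * d j - w j i * d i) = 0) ->
  (forall i, i \in A -> 0 < d i) -> (forall i, i \notin A -> d i <= 0) ->
  forall i j, i \in A -> j \notin A -> w j i = 0.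
Proof.
move=> w0 bal dA dNA i j iA jA.
have inner : \sum_(i in A) \sum_(j in A) (w i j * d j - w j i * d i) = 0.
  under eq_bigr do rewrite sumrB.
  by rewrite sumrB [X in _ - X]exchange_big subrr.
have cross : \sum_(i in A) \sum_(j | j \notin A) (w j i * d i - w i j * d j) = 0.
  have: \sum_(i in A) \sum_j (w i j * d j - w j i * d i) = 0 by exact: big1.
  under eq_bigr do rewrite (bigID (mem A)) /=.
  rewrite big_split /= inner add0r => /(congr1 -%R); rewrite oppr0 -sumrN => h.
  rewrite -[RHS]h; apply: eq_bigr => k _.
  by rewrite -sumrN; apply: eq_bigr => l _; rewrite opprB.
have flow0 k l : k \in A -> l \notin A -> 0 <= w l k * d k - w k l * d l.
  move=> kA lA; rewrite subr_ge0 (@le_trans _ _ 0) //.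
    by rewrite mulr_ge0_le0 ?dNA.
  by rewrite mulr_ge0 ?w0 ?ltW ?dA.
have cross_i : \sum_(j | j \notin A) (w j i * d i - w i j * d j) = 0.
  move: i iA; apply: psumr_eq0P cross => k kA.
  by apply: sumr_ge0 => l; exact: flow0.
have /eqP : w j i * d i - w i j * d j = 0.
  by move: j jA; apply: psumr_eq0P cross_i => l; exact: flow0.
rewrite subr_eq0 => /eqP h.
have : w j i * d i <= 0 by rewrite h mulr_ge0_le0 ?dNA.
by rewrite pmulr_lle0 ?dA // => wle; apply/le_anti; rewrite wle w0.
Qed.

(** * Adjoints, and the diagonal of the generator in an eigenbasis *)

Section Adjoint.
Context {C : numClosedFieldType} {n : nat}.
Implicit Types A B : 'M[C]_n.

Lemma adjE A i j : adj A i j = (A j i)^*.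
Proof. by rewrite !mxE. Qed.

Lemma adjM A B : adj (A *m B) = adj B *m adj A.
Proof. by rewrite /adj trmx_mul map_mxM. Qed.

Lemma adjK : involutive (@adj C n).
Proof. by move=> A; apply/matrixP => i j; rewrite !adjE conjCK. Qed.

Lemma adjD A B : adj (A + B) = adj A + adj B.
Proof. by rewrite /adj linearD map_mxD. Qed.

Lemma adjN A : adj (- A) = - adj A.
Proof. by rewrite /adj linearN map_mxN. Qed.

Lemma adjB A B : adj (A - B) = adj A - adj B.
Proof. by rewrite adjD adjN. Qed.

Lemma adjZ a A : adj (a *: A) = a^* *: adj A.
Proof. by rewrite /adj linearZ map_mxZ. Qed.

Lemma adj_sum (I : finType) (P : pred I) (F : I -> 'M[C]_n) :
  adj (\sum_(i | P i) F i) = \sum_(i | P i) adj (F i).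
Proof.
by apply: (big_morph (@adj C n) adjD); apply/matrixP => i j; rewrite !mxE conjC0.
Qed.

End Adjoint.

Lemma conj_diag_entry (C : numClosedFieldType) n (A : 'M[C]_n) (d : 'rV_n) i :
  (A *m diag_mx d *m adj A) i i = \sum_j `|A i j| ^+ 2 * d 0 j.
Proof.
rewrite mxE; apply: eq_bigr => j _.
by rewrite mul_mx_diag adjE !mxE normCK mulrAC.
Qed.

Definition dissipator (C : numClosedFieldType) n (L X : 'M[C]_n) : 'M[C]_n :=
  L *m X *m adj L - 2^-1 *: (adj L *m L *m X + X *m (adj L *m L)).

Lemma gkslE (C : numClosedFieldType) n (E : rel 'I_n) (c : 'I_n -> 'I_n -> C)
    (H X : 'M[C]_n) :
  gksl E c H X = - 'i *: (H *m X - X *m H) +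
    \sum_(p : 'I_n * 'I_n | E p.1 p.2) dissipator (jump (c p.1 p.2) p.1 p.2) X.
Proof. by []. Qed.

(** The source is the second index: [rate E c U i j] is the rate of jumping from eigenvector [j] to
    eigenvector [i]. *)
Definition rate (C : numClosedFieldType) n (E : rel 'I_n) (c : 'I_n -> 'I_n -> C)
    (U : 'M[C]_n) (i j : 'I_n) : C :=
  \sum_(p : 'I_n * 'I_n | E p.1 p.2)
    `|(U *m jump (c p.1 p.2) p.1 p.2 *m adj U) i j| ^+ 2.

Section EigenbasisBalance.
Context {C : numClosedFieldType} {n : nat} (U : 'M[C]_n) (d : 'rV[C]_n).
Hypothesis UU : U *m adj U = 1%:M.
Let X := adj U *m diag_mx d *m U.

Let UX A : U *m (A *m X) *m adj U = (U *m A *m adj U) *m diag_mx d.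
Proof. by rewrite /X -!mulmxA UU mulmx1. Qed.

Let XU A : U *m (X *m A) *m adj U = diag_mx d *m (U *m A *m adj U).
Proof. by rewrite /X !mulmxA UU mul1mx. Qed.

(** The sandwich term gives the gain. Since [X] is diagonal in this basis, the anticommutator gives
    twice the loss, and the factor one half compensates. *)
Lemma dissipator_diag L i : (U *m dissipator L X *m adj U) i i =
  \sum_j (`|(U *m L *m adj U) i j| ^+ 2 * d 0 j -
          `|(U *m L *m adj U) j i| ^+ 2 * d 0 i).
Proof.
have U1 : adj U *m U = 1%:M by exact: mulmx1C.
set A := U *m L *m adj U.
have AA : U *m (adj L *m L) *m adj U = adj A *m A.
  by rewrite /A !adjM adjK !mulmxA -(mulmxA _ (adj U) U) U1 mulmx1.
have gain : U *m (L *m X *m adj L) *m adj U = A *m diag_mx d *m adj A.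
  by rewrite /A /X !adjM adjK !mulmxA.
have norms : (adj A *m A) i i = \sum_j `|A j i| ^+ 2.
  by rewrite mxE; apply: eq_bigr => j _; rewrite adjE normCKC.
have loss : (adj A *m A *m diag_mx d + diag_mx d *m (adj A *m A)) i i =
    2 * \sum_j `|A j i| ^+ 2 * d 0 i.
  rewrite [LHS]mxE mul_mx_diag mul_diag_mx [X in X + _]mxE [X in _ + X]mxE norms.
  by rewrite [d 0 i * _]mulrC mulr_suml mulr2n mulrDl !mul1r.
rewrite /dissipator mulmxBr mulmxBl gain -scalemxAr -scalemxAl mulmxDr mulmxDl.
rewrite UX XU AA sumrB -conj_diag_entry [LHS]mxE; congr (_ + _).
by rewrite [LHS]mxE [X in - X]mxE loss mulKf ?pnatr_eq0.
Qed.

Lemma commutator_diag H i : (U *m (H *m X - X *m H) *m adj U) i i = 0.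
Proof.
rewrite mulmxBr mulmxBl UX XU mul_mx_diag mul_diag_mx [LHS]mxE.
by rewrite [X in X + _]mxE [X in _ + X]mxE [X in _ - X]mxE mulrC subrr.
Qed.

Lemma gksl_diag (E : rel 'I_n) (c : 'I_n -> 'I_n -> C) H i :
  (U *m gksl E c H X *m adj U) i i =
  \sum_j (rate E c U i j * d 0 j - rate E c U j i * d 0 i).
Proof.
rewrite gkslE mulmxDr mulmxDl -scalemxAr -scalemxAl [LHS]mxE.
rewrite [X in X + _]mxE commutator_diag mulr0 add0r mulmx_sumr mulmx_suml.
rewrite summxE; under eq_bigr do rewrite dissipator_diag.
rewrite exchange_big; apply: eq_bigr => j _.
by rewrite sumrB !mulr_suml.
Qed.

Lemma jump_conj_entry c v w i j :
  (U *m jump c v w *m adj U) i j = c * (U i w * (U j v)^*).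
Proof.
rewrite /jump -scalemxAr -scalemxAl mxE -(mul_delta_mx (0 : 'I_1)) -!mulmxA.
by rewrite -rowE mulmxA -colE mxE big_ord1 !mxE.
Qed.

End EigenbasisBalance.

(* The rows of [U] indexed by [A] span a subspace invariant under all the jump
   operators.  Jumping out of any vertex in the support of such a row produces a
   basis vector of the subspace; if no vertex there has an outgoing edge, all of
   them equal [s]. *)
Lemma invariant_rows_vanish (C : numClosedFieldType) n (E : rel 'I_n)
    (U : 'M[C]_n) (A : {pred 'I_n}) (i0 s : 'I_n) :
  U *m adj U = 1%:M -> (forall v, connect E v s) -> i0 \in A ->
  (forall v w i j, E v w -> i \in A -> j \notin A -> U j w * (U i v)^* = 0) ->
  forall j, j \notin A -> U j s = 0.
Proof.
move=> UU reach i0A inv j jA.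
have UU' := mulmx1C UU.
(* Vanishing of [U j v] for all [j] outside [A] says that the basis vector at [v] lies in the span
   of the rows in [A]; this property propagates along edges. *)
have fwd v w : connect E v w -> (forall j, j \notin A -> U j v = 0) ->
    forall j, j \notin A -> U j w = 0.
  move=> /connectP[p pth ->]; elim: p v pth => //= x p IH v /andP[vx pth] v0.
  (* Column [v] of [U] has norm one and vanishes outside [A], so some row in [A] has [v] in its
     support. *)
  apply: IH pth _ => k kA.
  have [i iA Uiv] : exists2 i, i \in A & U i v != 0.
    apply/exists_inP; apply: contraT => /exists_inPn U0.
    have /matrixP/(_ v v) := UU'.
    rewrite !mxE eqxx big1 => [/eqP|i _]; first by rewrite eq_sym oner_eq0.
    have [/U0|/v0 ->] := boolP (i \in A); last by rewrite mulr0.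
    by rewrite negbK => /eqP ->; rewrite mulr0.
  have /eqP := inv v x i k vx iA kA.
  by rewrite mulf_eq0 conjC_eq0 (negPf Uiv) orbF => /eqP.
have [] := boolP [exists v, exists w, E v w && (U i0 v != 0)].
  move=> /existsP[v /existsP[w /andP[vw Uv]]].
  apply: fwd (reach w) _ j jA => k kA.
  have /eqP := inv v w i0 k vw i0A kA.
  by rewrite mulf_eq0 conjC_eq0 (negPf Uv) orbF => /eqP.
move=> /existsPn noout.
(* A vertex other than [s] starts a nonempty path to [s], so it has an outgoing edge and row [i0]
   vanishes there. Row [i0] then lives on [s] alone, and orthogonality to it forces [U j s = 0]. *)
have U0 v : v != s -> U i0 v = 0.
  move=> vs; have /connectP[[|x p] /= pth sE] := reach v.
    by rewrite sE eqxx in vs.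
  case/andP: pth => vx _; move: (noout v) => /existsPn/(_ x).
  by rewrite vx /= negbK => /eqP.
have dot i : \sum_v U i v * (U i0 v)^* = (i == i0)%:R.
  by move/matrixP/(_ i i0): UU; rewrite !mxE => <-; apply: eq_bigr => v _; rewrite !mxE.
have dot_s i : U i s * (U i0 s)^* = (i == i0)%:R.
  rewrite -dot (bigD1 s) //= big1 ?addr0 // => v vs.
  by rewrite U0 // conjC0 mulr0.
have ji0 : j != i0 by apply: contraNneq jA => ->.
have /eqP := dot_s j; rewrite (negPf ji0) mulf_eq0 conjC_eq0 => /orP[/eqP //|/eqP U00].
by have /eqP := dot_s i0; rewrite U00 mul0r eqxx eq_sym oner_eq0.
Qed.

(** * A nonzero Hermitian matrix in the kernel of the generator *)

Lemma dissipator_is_linear (C : numClosedFieldType) n (L : 'M[C]_n) :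
  linear (dissipator L).
Proof.
move=> a X Y; rewrite /dissipator !(mulmxDr, mulmxDl) -!(scalemxAl, scalemxAr).
rewrite (addrACA (a *: (adj L *m L *m X))) -scalerDr.
rewrite [2^-1 *: (a *: _ + _)]scalerDr [2^-1 *: (a *: _)]scalerA [2^-1 * a]mulrC.
by rewrite -scalerA opprD addrACA -scalerBr.
Qed.

Lemma gksl_is_linear (C : numClosedFieldType) n (E : rel 'I_n)
    (c : 'I_n -> 'I_n -> C) (H : 'M[C]_n) : linear (gksl E c H).
Proof.
move=> a X Y; rewrite !gkslE !(mulmxDr, mulmxDl) -!(scalemxAl, scalemxAr).
under eq_bigr do rewrite dissipator_is_linear.
rewrite big_split -scaler_sumr opprD addrACA -scalerBr scalerDr.
by rewrite [- 'i *: (a *: _)]scalerA [- 'i * a]mulrC -scalerA addrACA -scalerDr.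
Qed.

HB.instance Definition _ (C : numClosedFieldType) n (E : rel 'I_n)
    (c : 'I_n -> 'I_n -> C) (H : 'M[C]_n) :=
  GRing.isLinear.Build C 'M[C]_n 'M[C]_n _ (gksl E c H) (gksl_is_linear E c H).

Lemma gksl_tr (C : numClosedFieldType) n (E : rel 'I_n)
    (c : 'I_n -> 'I_n -> C) (H X : 'M[C]_n) : \tr (gksl E c H X) = 0.
Proof.
rewrite gkslE linearD linearZ linearB /= (mxtrace_mulC X H) subrr mulr0 add0r.
rewrite linear_sum big1 //= => p _; rewrite /dissipator linearB linearZ linearD /=.
rewrite (mxtrace_mulC X) -mulr2n -[Z in _ * Z]mulr_natl mulKf ?pnatr_eq0 //.
by rewrite (mxtrace_mulC _ (adj _)) mulmxA subrr.
Qed.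

Lemma gksl_adj (C : numClosedFieldType) n (E : rel 'I_n)
    (c : 'I_n -> 'I_n -> C) (H X : 'M[C]_n) :
  is_hermitian H -> gksl E c H (adj X) = adj (gksl E c H X).
Proof.
rewrite /is_hermitian => Hh; rewrite !gkslE adjD adj_sum adjZ adjB !adjM Hh.
(* Taking adjoints flips the sign of the commutator as well as that of ['i], and the two cancel. *)
rewrite rmorphN /= conjCi opprK -[in RHS]opprB scalerN -scaleNr; congr (_ + _).
apply: eq_bigr => p _; move: (jump _ _ _) => L.
rewrite /dissipator adjB adjZ adjD !adjM !adjK fmorphV rmorph_nat !mulmxA.
by rewrite [_ + _ *m L]addrC.
Qed.

Lemma gksl_singular (C : numClosedFieldType) n (E : rel 'I_n)
    (c : 'I_n -> 'I_n -> C) (H : 'M[C]_n) :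
  (0 < n)%N -> exists2 X, X != 0 & gksl E c H X = 0.
Proof.
move=> n_gt0; pose M := lin_mx (gksl E c H).
have [Mu|] := boolP (M \in unitmx).
  (* If the generator were invertible, the identity would be one of its values, although its trace
     is [n] and not zero. *)
  have := gksl_tr E c H (vec_mx (mxvec 1%:M *m invmx M)).
  rewrite -mx_rV_lin mulmxKV // mxvecK mxtrace1 => /eqP.
  by rewrite pnatr_eq0 -leqn0 leqNgt n_gt0.
rewrite -row_free_unit -kermx_eq0 => /rowV0Pn[v /sub_kermxP vM v0].
exists (vec_mx v); first by apply: contra v0 => /eqP v0; rewrite -[v]vec_mxK v0 linear0.
by rewrite -mx_rV_lin vM linear0.
Qed.

Lemma gksl_hermitian_singular (C : numClosedFieldType) n (E : rel 'I_n)
    (c : 'I_n -> 'I_n -> C) (H : 'M[C]_n) : (0 < n)%N -> is_hermitian H ->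
  exists X, [/\ X != 0, is_hermitian X & gksl E c H X = 0].
Proof.
move=> n_gt0 Hh; have [X X0 gX] := gksl_singular E c H n_gt0.
have gX' : gksl E c H (adj X) = 0.
  by rewrite gksl_adj // gX; apply/matrixP => i j; rewrite !mxE conjC0.
have [XX|XX] := eqVneq (X + adj X) 0; last first.
  exists (X + adj X); split=> //; last by rewrite linearD /= gX gX' addr0.
  by rewrite /is_hermitian adjD adjK addrC.
(* Here [X] is anti-Hermitian, so multiplying it by ['i] makes it Hermitian. *)
exists ('i *: X); split; last by rewrite linearZ /= gX scaler0.
  by rewrite scaler_eq0 negb_or neq0Ci.
rewrite /is_hermitian adjZ conjCi; move/eqP: XX; rewrite addrC addr_eq0 => /eqP ->.
by rewrite scaleNr scalerN opprK.
Qed.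

(** * Eigenvalues of a Hermitian kernel element have one sign *)

Section SignOfEigenvalues.
Context {C : numClosedFieldType} {n : nat} {E : rel 'I_n} {c : 'I_n -> 'I_n -> C}.
Context {H : 'M[C]_n} {s : 'I_n}.
Hypothesis c_neq0 : forall v w : 'I_n, E v w -> c v w != 0.
Hypothesis reach : forall v, connect E v s.

Lemma positive_rows_vanish (U : 'M[C]_n) (d : 'rV[C]_n) :
  U *m adj U = 1%:M -> (forall i, d 0 i \is Num.real) ->
  gksl E c H (adj U *m diag_mx d *m U) = 0 ->
  forall i j, 0 < d 0 i -> d 0 j <= 0 -> U j s = 0.
Proof.
move=> UU dreal gX i j di dj.
pose A := [pred k | 0 < d 0 k].
have NA k : (k \notin A) = (d 0 k <= 0) by rewrite inE -real_leNgt ?real0.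
apply: (@invariant_rows_vanish _ _ E U A i) => //; last by rewrite NA.
move=> v w k l vw kA lA.
have rate_ge0 i' j' p : E p.1 p.2 ->
    0 <= `|(U *m jump (c p.1 p.2) p.1 p.2 *m adj U) i' j'| ^+ 2.
  by rewrite exprn_ge0.
(* A vanishing rate is a vanishing sum of squares, so every single edge contributes zero. *)
have /(psumr_eq0P (rate_ge0 l k))/(_ (v, w) vw)/eqP : rate E c U l k = 0.
  apply: (balanced_rates_closed (d := d 0) (A := A)) kA lA => //.
  - by move=> i' j'; apply: sumr_ge0 => p; exact: rate_ge0.
  - by move=> i'; rewrite -(gksl_diag d UU E c H) gX mulmx0 mul0mx mxE.
  - by move=> i'; rewrite NA.
rewrite sqrf_eq0 normr_eq0 jump_conj_entry //= mulf_eq0.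
by rewrite (negPf (c_neq0 vw)) => /eqP.
Qed.

(** With eigenvalues of both signs, [positive_rows_vanish] for [d] and for [- d] together kills all
    of column [s] of [U], against unitarity. *)
Lemma same_sign_spectrum (U : 'M[C]_n) (d : 'rV[C]_n) :
  U *m adj U = 1%:M -> (forall i, d 0 i \is Num.real) ->
  gksl E c H (adj U *m diag_mx d *m U) = 0 ->
  (forall i, 0 <= d 0 i) \/ (forall i, d 0 i <= 0).
Proof.
move=> UU dreal gX.
have [/forallP ?|/forallPn[i /=]] := boolP [forall i, 0 <= d 0 i]; first by left.
rewrite -real_ltNge ?real0 // => di; right => j.
rewrite real_leNgt ?real0 //; apply/negP => dj.
have gNX : gksl E c H (adj U *m diag_mx (- d) *m U) = 0.
  by rewrite linearN mulmxN mulNmx linearN /= gX oppr0.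
have Us0 k : U k s = 0.
  have [dk|dk] := real_leP (dreal k) (@real0 C).
    exact: (positive_rows_vanish UU dreal gX dj dk).
  apply: (positive_rows_vanish UU _ gNX (i := i)).
  - by move=> l; rewrite mxE realN.
  - by rewrite mxE oppr_gt0.
  - by rewrite mxE oppr_le0 ltW.
have /matrixP/(_ s s) := mulmx1C UU.
rewrite !mxE eqxx big1 => [/eqP|k _]; first by rewrite eq_sym oner_eq0.
by rewrite Us0 mulr0.
Qed.

End SignOfEigenvalues.

(** * Spectral decomposition and the unique stationary state *)

Lemma hermitian_diagonalization (C : numClosedFieldType) n (X : 'M[C]_n) :
  is_hermitian X -> exists (U : 'M[C]_n) (d : 'rV[C]_n),
    [/\ U *m adj U = 1%:M, forall i, d 0 i \is Num.real
      & X = adj U *m diag_mx d *m U].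
Proof.
move=> Xh; have Xs : X \is hermsymmx.
  by apply/is_hermitianmxP; rewrite expr0 scale1r -[LHS]Xh.
have Uu := spectral_unitarymx X.
exists (spectralmx X), (spectral_diag X); split.
- exact/unitarymxP.
- by move=> i; have /mxOverP := hermitian_spectral_diag_real Xs; exact.
- rewrite {1}(orthomx_spectralP (hermitian_normalmx Xs)).
  by rewrite invmx_unitary.
Qed.

Lemma psd_of_spectrum (C : numClosedFieldType) n (U : 'M[C]_n) (d : 'rV[C]_n) :
  (forall i, 0 <= d 0 i) -> psd (adj U *m diag_mx d *m U).
Proof.
move=> d0; split=> [|x].
  rewrite /is_hermitian !adjM adjK mulmxA; congr (_ *m _ *m _).
  apply/matrixP => i j; rewrite adjE !mxE eq_sym; case: eqVneq => [->|_].
    by rewrite mulr1n conj_Creal // ger0_real.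
  by rewrite mulr0n conjC0.
have -> : map_mx Num.conj x^T *m (adj U *m diag_mx d *m U) *m x =
    map_mx Num.conj (U *m x)^T *m diag_mx d *m (U *m x).
  by rewrite trmx_mul map_mxM !mulmxA.
rewrite mxE; apply: sumr_ge0 => i _; rewrite mul_mx_diag !mxE mulrAC.
by rewrite mulr_ge0 // mulrC mul_conjC_ge0.
Qed.

Lemma tr_spectrum (C : numClosedFieldType) n (U : 'M[C]_n) (d : 'rV[C]_n) :
  U *m adj U = 1%:M -> \tr (adj U *m diag_mx d *m U) = \sum_i d 0 i.
Proof. by move=> UU; rewrite mxtrace_mulC mulmxA UU mul1mx mxtrace_diag. Qed.

Theorem theorem2 (C : numClosedFieldType) (n : nat) (E : rel 'I_n)
    (c : 'I_n -> 'I_n -> C) (H : 'M[C]_n) :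
  weakly_connected E ->
  #|cond_sinks E| = 1%N ->
  (forall v w : 'I_n, E v w -> c v w != 0) ->
  is_hermitian H ->
  relaxing E c H.
Proof.
move=> _ sink c_neq0 Hh; have [s reach] := globally_reachable sink.
have traceless X : is_hermitian X -> gksl E c H X = 0 -> \tr X = 0 -> X = 0.
  move=> Xh; have [U [d [UU dreal ->]]] := hermitian_diagonalization Xh.
  move=> gX; rewrite tr_spectrum // => sum0.
  suff -> : d = 0 by rewrite linear0 mulmx0 mul0mx.
  apply/rowP => i; rewrite mxE.
  have [d0|d0] := same_sign_spectrum c_neq0 reach UU dreal gX.
    exact: (psumr_eq0P _ sum0).
  apply/oppr_inj; rewrite oppr0; apply: (@psumr_eq0P _ _ predT (fun i => - d 0 i)) => //.
    by move=> j _; rewrite oppr_ge0.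
  by rewrite sumrN sum0 oppr0.
have n_gt0 : (0 < n)%N by exact: leq_ltn_trans (leq0n s) (ltn_ord s).
have [X [X0 Xh gX]] := gksl_hermitian_singular E c n_gt0 Hh.
have trX0 : \tr X != 0 by apply: contra X0 => /eqP trX0; rewrite (traceless X).
pose rho0 := (\tr X)^-1 *: X.
have tr0 : \tr rho0 = 1 by rewrite linearZ /= mulVf.
have grho0 : gksl E c H rho0 = 0 by rewrite linearZ /= gX scaler0.
have psd0 : psd rho0.
  rewrite /rho0; move: gX; have [U [d [UU dreal ->]]] := hermitian_diagonalization Xh.
  rewrite tr_spectrum // => gX.
  (* The trace has the common sign of the eigenvalues, so dividing by it makes them all nonnegative,
     whichever sign that was. *)
  rewrite scalemxAl scalemxAr -linearZ; apply: psd_of_spectrum => i.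
  rewrite mxE; have [d0|d0] := same_sign_spectrum c_neq0 reach UU dreal gX.
    by rewrite mulr_ge0 // invr_ge0 sumr_ge0.
  by rewrite mulr_le0 // invr_le0 sumr_le0.
exists rho0; split=> // rho [[[rh _] tr1] grho].
(* The difference of two stationary states is Hermitian, traceless and in the kernel. *)
apply/eqP; rewrite -subr_eq0; apply/eqP/traceless.
- by rewrite /is_hermitian adjB rh (proj1 psd0).
- by rewrite linearB /= grho grho0 subr0.
- by rewrite linearB /= tr1 tr0 subrr.
Qed.
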